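(* Let $n,k$ be positive integers and let $V\subseteq\mathbb{Z}^+$ be a finite set of odd size. If $a_1,a_2,\dots,a_k\in\mathbb{Z}^+$ (not necessarily distinct), then $$\left|V\oplus\bigoplus_{i=1}^k \{a_i,2a_i,\dots,na_i\}\right|\geq n.$$
   Context: $\mathbb{Z}^+$ denotes the set of positive integers. For finite sets $A,B\subseteq\mathbb{Z}$, $A\oplus B$ denotes the set of those integers that can be represented as $a+b$ with $a\in A$, $b\in B$ in an odd number of ways (i.e. for an odd number of pairs $(a,b)\in A\times B$). This operation is associative and commutative, and $\bigoplus_{i=1}^k S_i = S_1\oplus S_2\oplus\dots\oplus S_k$ denotes the iterated operation; equivalently, it is the set of integers $m$ for which the number of tuples $(s_1,\dots,s_k)\in S_1\times\dots\times S_k$ with $s_1+\dots+s_k=m$ is odd. For $k=1$ it is just $S_1$. Thus $V\oplus\bigoplus_{i=1}^k S_i = V\oplus S_1\oplus\dots\oplus S_k$. *)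

(* Defs.v *)
From HB Require Import structures.
From mathcomp Require Import all_boot all_order all_algebra finmap.

Set Implicit Arguments.
Unset Strict Implicit.
Unset Printing Implicit Defensive.

Import Order.TTheory GRing.Theory Num.Theory.

Local Open Scope fset_scope.
Local Open Scope ring_scope.

(* The comprehension over the sumset only serves to bound the carrier: see
   [in_oplus] for the unrestricted membership criterion. *)
Definition oplus (A B : {fset int}) : {fset int} :=
  [fset m in [fset a + b | a in A, b in B]
     | odd #|` [fset p in A `*` B | p.1 + p.2 == m]|].

Definition multiples (n : nat) (a : int) : {fset int} :=
  [fset i%:Z * a | i in iota 1 n].

Lemma in_oplus (A B : {fset int}) (m : int) :
  (m \in oplus A B) = odd #|` [fset p in A `*` B | p.1 + p.2 == m]|.
Proof.
rewrite in_fset inE /= andbC; case: (boolP (odd _)) => //= hodd.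
have : [fset p in A `*` B | p.1 + p.2 == m] != fset0.
  by apply: contraTneq hodd => ->; rewrite cardfs0.
case/fset0Pn => -[a b]; rewrite !inE /= => /andP[/andP[aA bB] /eqP <-].
by apply/imfset2P; exists a => //; exists b.
Qed.

Lemma in_oplus_addb (A B : {fset int}) (m : int) :
  (m \in oplus A B) =
  \big[addb/false]_(a <- A) \big[addb/false]_(b <- B) (a + b == m).
Proof.
rewrite in_oplus card_fset_sum1 big_fset /= big_mkcond /=.
rewrite (big_morph odd oddD (erefl _)) big_imfset2 /=; last first.
  by move=> [a b] [c d] _ _ /= [-> ->].
by apply: eq_bigr => a _; apply: eq_bigr => b _; case: eqP.
Qed.

Lemma big_addb_pred1 (A : {fset int}) (c : int) (f : int -> bool) :
  \big[addb/false]_(x <- A) ((c == x) && f x) = (c \in A) && f c.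
Proof.
case: (boolP (c \in A)) => cA /=; last first.
  by rewrite big_seq big1 // => x xA; case: eqP cA => // ->; rewrite xA.
rewrite (big_fsetD1 c) //= eqxx big1_fset ?addbF //= => x.
by rewrite !inE eq_sym => /andP[/negPf ->].
Qed.

Lemma big_addb_oplus (A B : {fset int}) (f : int -> bool) :
  \big[addb/false]_(x <- oplus A B) f x =
  \big[addb/false]_(a <- A) \big[addb/false]_(b <- B) f (a + b).
Proof.
pose I := [fset a + b | a in A, b in B].
rewrite big_fset big_mkcond /= -/I.
transitivity (\big[addb/false]_(x <- I) \big[addb/false]_(a <- A)
                \big[addb/false]_(b <- B) ((a + b == x) && f x)).
  apply: eq_fbigr => x xI _; rewrite -in_oplus; case: ifP => h; symmetry.
    under eq_bigr do rewrite -big_distrl.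
    by rewrite -big_distrl /= -in_oplus_addb h.
  under eq_bigr do rewrite -big_distrl.
  by rewrite -big_distrl /= -in_oplus_addb h.
rewrite exchange_big; apply: eq_fbigr => a aA _ /=.
rewrite exchange_big; apply: eq_fbigr => b bB _ /=.
rewrite big_addb_pred1; suff -> : a + b \in I by [].
by apply/imfset2P; exists a => //; exists b.
Qed.

Lemma oplusC : commutative oplus.
Proof.
move=> A B; apply/fsetP => m; rewrite !in_oplus_addb exchange_big /=.
by apply: eq_bigr => b _; apply: eq_bigr => a _; rewrite addrC.
Qed.

Lemma oplusA : associative oplus.
Proof.
move=> A B C; apply/fsetP => m; rewrite !in_oplus_addb.
rewrite (big_addb_oplus A B (fun x => \big[addb/false]_(c <- C) (x + c == m))).
apply: eq_bigr => a _; rewrite (big_addb_oplus B C (fun x => a + x == m)).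
by do 2![apply: eq_bigr => ? _]; rewrite addrA.
Qed.

Lemma oplus0s : left_id [fset 0] oplus.
Proof.
move=> A; apply/fsetP => m; rewrite in_oplus_addb big_seq_fset1.
transitivity (\big[addb/false]_(x <- A) ((m == x) && true)).
  by apply: eq_bigr => b _; rewrite add0r eq_sym andbT.
by rewrite (big_addb_pred1 A m xpredT) andbT.
Qed.

HB.instance Definition _ :=
  Monoid.isComLaw.Build {fset int} [fset 0] oplus oplusA oplusC oplus0s.

(* Main.v *)
Require Import Defs.
From mathcomp Require Import all_boot all_order all_algebra finmap ring zify.

Set Implicit Arguments.
Unset Strict Implicit.
Unset Printing Implicit Defensive.

Import Order.TTheory GRing.Theory Num.Theory.
Local Open Scope fset_scope.
Local Open Scope ring_scope.

(** A finite set of nonnegative integers is read as a polynomial over the field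
    with two elements: its elements are the exponents. Then [oplus] is the product,
    the cardinal is the number of nonzero coefficients (the weight), the parity of
    the cardinal is the value at 1, and the claim says that
      P = v * \prod_i (1 + X^(a_i) + ... + X^((n-1) a_i)),  v(1) = 1,
    has weight at least n; v absorbs the lowest monomials X^(a_i) of the progressions,
    which do not change v(1).

    Write n = 2^s m with m odd. In characteristic 2 each geometric sum factors as
      (X^(m a_i) - 1)^(2^s - 1) * (1 + X^(a_i) + ... + X^((m-1) a_i)).
    Let g be the gcd of the a_i, let N = g m, and let w be v times the product of
    the second factors. The first factors are polynomials in X^N, because N divides
    every m a_i, so sorting the monomials of P by their exponent modulo N gives parts
    of the form U * w_r, where w_r is the part of w in the class r and
    U = p^(2^s - 1), p = \prod_i (X^(a_i / g) - 1), once X^N is renamed X. The bound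
    n = m 2^s then comes from two facts.

    - At least m of the w_r do not vanish at 1. Modulo X^N - 1, multiplication by
      X^(a_i) fixes w for each i, hence so does multiplication by X^g, and
      w_r(1) depends only on r modulo g. As m is odd, w(1), which is the sum of all
      the w_r(1), is nonzero; so some w_r(1) is nonzero, and with it those of the
      m residues congruent to r modulo g ([residue_part_period]).

    - If w_r(1) is nonzero then U * w_r has weight at least 2^s
      ([leq_weight_exp_ones]). Indeed the order of vanishing of U * w_r at 1 is a
      positive multiple of 2^s - 1, and in characteristic 2 a polynomial that
      vanishes at 1 to order exactly M has at least 2^(popcount M) nonzero
      coefficients, where popcount counts the binary digits 1
      ([leq_weight_XsubC1_exp]). A positive multiple of 2^s - 1 has at least s of
      these digits ([leq_popcount_mul_ones]). *)

(** * Binary digit sums *)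

(** The sum stops at [n] only because [n < 2 ^ n]; see [popcount_widen]. *)
Definition popcount (n : nat) : nat := (\sum_(i < n) odd (n %/ 2 ^ i))%N.

Lemma popcount_widen (K n : nat) : (n <= K)%N ->
  popcount n = (\sum_(i < K) odd (n %/ 2 ^ i))%N.
Proof.
move=> le_nK; rewrite /popcount.
rewrite (big_ord_widen K (fun i => odd (n %/ 2 ^ i) : nat) le_nK) big_mkcond /=.
apply: eq_bigr => i _; case: ltnP => // le_ni.
by rewrite divn_small // (leq_ltn_trans le_ni) // ltn_expl.
Qed.

Lemma popcount_bit_double (b : bool) (n : nat) :
  popcount (b + n.*2) = (b + popcount n)%N.
Proof.
rewrite (@popcount_widen (b + n.*2).+1) // big_ord_recl /= expn0 divn1.
rewrite oddD odd_double addbF oddb; congr addn.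
rewrite (@popcount_widen (b + n.*2)); last by lia.
apply: eq_bigr => i _ /=.
by rewrite /bump /= add1n expnS divnMA divn2 half_bit_double.
Qed.

Lemma popcount_half (n : nat) : popcount n = (odd n + popcount n./2)%N.
Proof. by rewrite -popcount_bit_double odd_double_half. Qed.

Lemma popcount_concat (s q r : nat) : (r < 2 ^ s)%N ->
  popcount (q * 2 ^ s + r) = (popcount q + popcount r)%N.
Proof.
elim: s q r => [|s IHs] q r ltr.
  have -> : r = 0%N by lia.
  by rewrite expn0 muln1 addn0 /popcount big_ord0 addn0.
rewrite -{1}(odd_double_half r).
have -> : (q * 2 ^ s.+1 + (odd r + r./2.*2) =
           odd r + (q * 2 ^ s + r./2).*2)%N by rewrite expnS; lia.
rewrite popcount_bit_double IHs; last by rewrite expnS in ltr; lia.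
by rewrite (popcount_half r); lia.
Qed.

Lemma popcountS (n : nat) : (popcount n.+1 <= (popcount n).+1)%N.
Proof.
elim/ltn_ind: n => n IHn; rewrite (popcount_half n.+1) (popcount_half n) /=.
rewrite uphalf_half; case: (boolP (odd n)) => [odd_n|_] //=.
by rewrite add0n add1n ltnW // ltnS; apply: IHn; lia.
Qed.

(** Every carry in the addition of [m] and [n] trades two digits 1 for a single one. *)
Lemma popcountD (m n : nat) : (popcount (m + n) <= popcount m + popcount n)%N.
Proof.
elim/ltn_ind: m n => m IHm n; case: (posnP m) => [->|m_gt0]; first by rewrite add0n leq_addl.
have ltm : (m./2 < m)%N by lia.
rewrite (popcount_half m) (popcount_half n).
have -> : (m + n = (odd m (+) odd n) + ((odd m && odd n) + (m./2 + n./2)).*2)%N.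
  by rewrite -{1}(odd_double_half m) -{1}(odd_double_half n); do 2!case: odd => /=; lia.
rewrite popcount_bit_double.
have IH := IHm _ ltm n./2; have := popcountS (m./2 + n./2).
by do 2!case: odd => /=; rewrite ?add0n ?add1n; lia.
Qed.

Lemma popcount_ones (s : nat) : popcount (2 ^ s - 1) = s.
Proof.
elim: s => [|s IHs]; first by rewrite /popcount big_ord0.
have -> : (2 ^ s.+1 - 1 = true + (2 ^ s - 1).*2)%N.
  by have := expn_gt0 2 s; rewrite expnS; lia.
by rewrite popcount_bit_double IHs.
Qed.

(** Casting out [2 ^ s - 1]: replacing [q * 2 ^ s + r] by [q + r] keeps the residue
    modulo [2 ^ s - 1] and positivity and cannot increase the digit sum; it ends at
    the only positive multiple below [2 ^ s], which is [2 ^ s - 1] itself. *)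
Lemma leq_popcount_mul_ones (s B : nat) : (0 < B)%N ->
  (s <= popcount ((2 ^ s - 1) * B))%N.
Proof.
case: (posnP s) => [-> //|s_gt0] B_gt0.
have lt1s : (1 < 2 ^ s)%N by rewrite -{1}(expn0 2) ltn_exp2l.
have [M] := ubnP ((2 ^ s - 1) * B); elim: M B B_gt0 => // M IHM B B_gt0 leM.
set x := ((2 ^ s - 1) * B)%N.
have x_eq := divn_eq x (2 ^ s); have r_lt := ltn_pmod x (ltnW lt1s).
set q := (x %/ 2 ^ s)%N in x_eq; set r := (x %% 2 ^ s)%N in x_eq r_lt.
(* q = 0 means x < 2 ^ s, which forces B = 1. *)
have [q0|q_gt0] := posnP q.
  have -> : x = (2 ^ s - 1)%N by rewrite /x in x_eq *; nia.
  by rewrite popcount_ones.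
have lt_qB : (q < B)%N by rewrite /x in x_eq; nia.
have fold : (q + r = (2 ^ s - 1) * (B - q))%N by rewrite /x in x_eq; nia.
rewrite x_eq popcount_concat //; apply: leq_trans (popcountD _ _).
by rewrite fold; apply: IHM; nia.
Qed.

(** * Weights and residue classes of exponents *)

Definition weight (R : nzSemiRingType) (p : {poly R}) : nat :=
  (\sum_(i < size p) (p`_i != 0)%R)%N.

Lemma weight_widen (R : nzSemiRingType) (K : nat) (p : {poly R}) :
  (size p <= K)%N -> weight p = (\sum_(i < K) (p`_i != 0)%R)%N.
Proof.
move=> le_pK; rewrite /weight (big_ord_widen K (fun i => p`_i != 0 : nat) le_pK) big_mkcond /=.
by apply: eq_bigr => i _; case: ltnP => // le_pi; rewrite nth_default ?eqxx.
Qed.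

Lemma weight_gt0 (R : nzSemiRingType) (p : {poly R}) : p != 0 -> (0 < weight p)%N.
Proof.
move=> p0; have sz : (0 < size p)%N by rewrite size_poly_gt0.
have lt : ((size p).-1 < size p)%N by lia.
rewrite /weight (bigD1 (Ordinal lt)) //= -/(lead_coef p) lead_coef_eq0 p0.
by rewrite add1n.
Qed.

Lemma big_divmod (R : Type) (idx : R) (op : Monoid.com_law idx) (K N : nat)
    (f : nat -> R) :
  \big[op/idx]_(i < K * N) f i = \big[op/idx]_(r < N) \big[op/idx]_(q < K) f (q * N + r)%N.
Proof.
rewrite -(big_mkord xpredT f) big_nat_mul big_mkord exchange_big /=.
apply: eq_bigr => q _; rewrite -{1}[(q * N)%N]add0n big_addn mulSn addnK big_mkord.
by apply: eq_bigr => r _; rewrite addnC.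
Qed.

(** The monomials of [p] whose exponent is [r] modulo [N], with exponents rescaled
    by [i * N + r |-> i]; the rescaling changes neither the weight nor the value at 1.
    The bound [size p] is generous but never truncates ([coef_residue_part]). *)
Definition residue_part (R : nzSemiRingType) (N r : nat) (p : {poly R}) : {poly R} :=
  \poly_(i < size p) p`_(i * N + r).

Lemma coef_residue_part (R : nzSemiRingType) (N r : nat) (p : {poly R}) (i : nat) :
  (0 < N)%N -> (residue_part N r p)`_i = p`_(i * N + r).
Proof.
move=> N_gt0; rewrite coef_poly; case: ltnP => // le_pi.
by rewrite nth_default // (leq_trans le_pi) //; nia.
Qed.

Lemma size_residue_part (R : nzSemiRingType) (N r : nat) (p : {poly R}) :
  (size (residue_part N r p) <= size p)%N.
Proof. exact: size_poly. Qed.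

Lemma weight_residue_part (R : nzSemiRingType) (N : nat) (p : {poly R}) : (0 < N)%N ->
  weight p = (\sum_(r < N) weight (residue_part N r p))%N.
Proof.
move=> N_gt0; have le_pK : (size p <= size p * N)%N by nia.
rewrite (weight_widen le_pK) (big_divmod _ _ _ (fun i => p`_i != 0 : nat)).
apply: eq_bigr => r _; rewrite (weight_widen (size_residue_part N r p)).
by apply: eq_bigr => q _; rewrite coef_residue_part.
Qed.

Lemma horner1_residue_part (R : nzSemiRingType) (N : nat) (p : {poly R}) : (0 < N)%N ->
  p.[1] = \sum_(r < N) (residue_part N r p).[1].
Proof.
move=> N_gt0; have le_pK : (size p <= size p * N)%N by nia.
rewrite (horner_coef_wide _ le_pK).
under eq_bigr do rewrite expr1n mulr1.
rewrite (big_divmod _ _ _ (fun i => p`_i)); apply: eq_bigr => r _.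
rewrite (horner_coef_wide _ (size_residue_part N r p)); apply: eq_bigr => q _.
by rewrite coef_residue_part // expr1n mulr1.
Qed.

Lemma residue_partD (R : nzSemiRingType) (N r : nat) (p q : {poly R}) : (0 < N)%N ->
  residue_part N r (p + q) = residue_part N r p + residue_part N r q.
Proof. by move=> N_gt0; apply/polyP => i; rewrite coefD !coef_residue_part // coefD. Qed.

(** Multiplying by a polynomial in ['X^N] does not mix the residue classes modulo
    [N], so taking a part is linear over such polynomials. *)
Lemma residue_part_comp_mul (R : comNzRingType) (N r : nat) (u p : {poly R}) :
  (0 < N)%N -> (r < N)%N -> residue_part N r ((u \Po 'X^N) * p) = u * residue_part N r p.
Proof.
move=> N_gt0 lt_rN; elim/poly_ind: u p => [|u c IHu] p.
  by rewrite comp_poly0 !mul0r; apply/polyP => i; rewrite coef_residue_part // !coef0.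
have mulS (f : {poly R}) : residue_part N r (c%:P * f) = c%:P * residue_part N r f.
  by apply/polyP => i; rewrite coefCM !coef_residue_part // coefCM.
have shiftS (f : {poly R}) : residue_part N r ('X^N * f) = 'X * residue_part N r f.
  apply/polyP => i; rewrite coefXM !coef_residue_part // coefXnM.
  by case: i => [|i] /=; rewrite ?mul0n ?lt_rN // ifF; [congr nth|]; nia.
rewrite comp_poly_MXaddC mulrDl residue_partD // mulS -mulrA IHu shiftS.
by rewrite mulrDl mulrA.
Qed.

Lemma residue_part_shift (R : nzSemiRingType) (N g r : nat) (p : {poly R}) :
  (0 < N)%N -> residue_part N (r + g) ('X^g * p) = residue_part N r p.
Proof.
move=> N_gt0; apply/polyP => i; rewrite !coef_residue_part // coefXnM.
by rewrite ifF; [congr nth|]; lia.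
Qed.

(** * Characteristic two *)

Section CharTwo.

Variables (F : fieldType) (charF2 : 2%N \in [pchar F]).
Implicit Types p q f h : {poly F}.

Lemma pchar2_poly : 2%N \in [pchar {poly F}].
Proof. by rewrite (pchar_lalg {poly F}). Qed.

(** Induction on the binary digits of [M]. Since [('X - 1) ^+ 2 = 'X^2 - 1], splitting
    into even and odd exponents strips the last digit [b] of [M] and leaves the two
    parts of [('X - 1) ^+ b * h]. If [b] is 0 at least one of them is nonzero at 1;
    if [b] is 1 their values at 1 have sum 0 and both are nonzero, which doubles the
    bound. *)
Lemma leq_weight_XsubC1_exp (M : nat) (h : {poly F}) : h.[1] != 0 ->
  (2 ^ popcount M <= weight (('X - 1) ^+ M * h))%N.
Proof.
elim/ltn_ind: M h => M IHM h h1.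
case: (posnP M) => [->|M_gt0].
  rewrite /popcount big_ord0 expr0 mul1r weight_gt0 //.
  by apply: contraNneq h1 => ->; rewrite horner0.
have ltM : (M./2 < M)%N by lia.
have sqX : ('X - 1) ^+ 2 = ('X - 1) \Po 'X^2 :> {poly F}.
  rewrite comp_polyB comp_polyX comp_polyC.
  by rewrite -(pFrobenius_autE pchar2_poly) rmorphB /= !pFrobenius_autE expr1n.
have -> : ('X - 1) ^+ M * h = (('X - 1) ^+ M./2 \Po 'X^2) * (('X - 1) ^+ odd M * h).
  rewrite rmorphXn /= -sqX -exprM mulrA -exprD; congr (_ ^+ _ * _).
  by rewrite mul2n addnC odd_double_half.
rewrite (weight_residue_part _ (isT : 0 < 2)%N) big_ord_recl big_ord1 /=.
rewrite !residue_part_comp_mul //.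
have := horner1_residue_part h (isT : 0 < 2)%N.
rewrite big_ord_recl big_ord1 /= (popcount_half M) => h1E.
case: (odd M) => /=; last first.
  rewrite expr0 mul1r add0n.
  have [h0|h0] := eqVneq (residue_part 2 0 h).[1] 0.
    apply: leq_trans (IHM _ ltM (residue_part 2 1 h) _) (leq_addl _ _).
    by rewrite h1E h0 add0r in h1.
  exact: leq_trans (IHM _ ltM _ h0) (leq_addr _ _).
(* The even part of ('X - 1) * h takes at 1 the value h_1 - h_0 = h_1 + h_0 = h(1),
   where h_0 and h_1 are the values at 1 of the parts of h. *)
have h0 : (residue_part 2 0 (('X - 1) * h)).[1] != 0.
  have -> : residue_part 2 0 (('X - 1) * h) = 'X * residue_part 2 1 h - residue_part 2 0 h.
    apply/polyP => i; rewrite coefB coefXM !coef_residue_part // mulrBl mul1r coefB coefXM.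
    by case: i => [|i]; rewrite ?mul0n // addn0 addn1 mulSn.
  rewrite hornerD hornerN hornerM hornerX mul1r.
  by rewrite (oppr_pchar2 charF2) addrC -h1E.
(* The product vanishes at 1, so its odd part takes there the opposite value. *)
have /eqP := horner1_residue_part (('X - 1) * h) (isT : 0 < 2)%N.
rewrite hornerM hornerD hornerX hornerN hornerC subrr mul0r.
rewrite big_ord_recl big_ord1 /= eq_sym addr_eq0 => /eqP h01.
rewrite expr1 expnD expn1 mul2n -addnn leq_add ?IHM //.
by rewrite h01 oppr_eq0 in h0.
Qed.

(** The order of vanishing at 1 of the product is [2 ^ s - 1] times that of [p]. *)
Lemma leq_weight_exp_ones (s : nat) (p f : {poly F}) :
  p != 0 -> p.[1] = 0 -> f.[1] != 0 ->
  (2 ^ s <= weight (p ^+ (2 ^ s - 1) * f))%N.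
Proof.
move=> p_neq0 p1 f1; have [e [q q1 pE]] := multiplicity_XsubC p 1.
rewrite p_neq0 /= in q1.
have e_gt0 : (0 < e)%N.
  case: e pE => // pE; case/negP: q1.
  by rewrite -[q]mulr1 -(expr0 ('X - 1%:P)) -pE; apply/rootP.
have -> : p ^+ (2 ^ s - 1) * f =
    ('X - 1) ^+ ((2 ^ s - 1) * e) * (q ^+ (2 ^ s - 1) * f).
  by rewrite pE exprMn -exprM [(e * _)%N]mulnC mulrCA mulrA.
apply: leq_trans (leq_weight_XsubC1_exp _ _).
  by rewrite leq_exp2l // leq_popcount_mul_ones.
by rewrite hornerM horner_exp mulf_neq0 // expf_neq0.
Qed.

Lemma geometric_pow2 (s : nat) (y : {poly F}) :
  \sum_(j < 2 ^ s) y ^+ j = (y - 1) ^+ (2 ^ s - 1).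
Proof.
elim: s => [|s IHs].
  by rewrite expn0 big_ord1 expr0 subnn expr0.
rewrite expnS mulnC (big_divmod _ _ _ (fun j => y ^+ j)).
rewrite big_ord_recl big_ord1 /=.
have -> : (2 ^ s * 2 - 1 = (2 ^ s - 1) * 2 + 1)%N.
  by have := expn_gt0 2 s; lia.
rewrite exprD exprM -IHs -(pFrobenius_autE pchar2_poly) rmorph_sum /= expr1.
have fr (j : nat) : pFrobenius_aut pchar2_poly (y ^+ j) = y ^+ (j * 2).
  by rewrite pFrobenius_autE exprM.
under [X in X * _]eq_bigr do rewrite fr.
rewrite mulrBr mulr1 (oppr_pchar2 pchar2_poly) addrC.
congr (_ + _); last by apply: eq_bigr => j _; rewrite addn0.
by rewrite big_distrl; apply: eq_bigr => j _ /=; rewrite exprD expr1.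
Qed.

(** Sorting the exponents [j = q * m + r] leaves a geometric sum of length [2 ^ s] in
    [y ^+ m], which is a power by [geometric_pow2]. *)
Lemma geometric_split (s m : nat) (y : {poly F}) :
  \sum_(j < 2 ^ s * m) y ^+ j =
  (y ^+ m - 1) ^+ (2 ^ s - 1) * \sum_(j < m) y ^+ j.
Proof.
rewrite (big_divmod _ _ _ (fun j => y ^+ j)) -geometric_pow2 mulr_sumr.
apply: eq_bigr => r _; rewrite mulr_suml; apply: eq_bigr => q _.
by rewrite exprD mulnC exprM.
Qed.

(** The exponents [t] such that ['X^t] acts trivially on [w] modulo [d] are closed
    under gcd, by a Bezout relation [u * a = v * b + gcdn a b]. *)
Lemma period_gcd (d w : {poly F}) (a b : nat) :
  d %| ('X^a - 1) * w -> d %| ('X^b - 1) * w -> d %| ('X^(gcdn a b) - 1) * w.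
Proof.
case: (posnP a) => [->|a_gt0] da db; first by rewrite gcd0n.
have mult (c u : nat) : d %| ('X^c - 1) * w -> d %| ('X^(c * u) - 1) * w.
  by move=> dc; rewrite exprM subrX1 mulrAC dvdp_mulr.
have [u v eq_uv _] := egcdnP b a_gt0.
have -> : ('X^(gcdn a b) - 1) * w =
    ('X^(a * u) - 1) * w - 'X^(gcdn a b) * (('X^(b * v) - 1) * w).
  by rewrite [(a * u)%N]mulnC eq_uv [(v * b)%N]mulnC exprD; ring.
by apply: dvdp_sub; [|apply: dvdp_mull]; apply: mult.
Qed.

(** Modulo ['X^N - 1] the value at 1 of a residue part is well defined, and
    multiplication by ['X^g] moves the class [r] to the class [r + g]. *)
Lemma residue_part_period (N g c j : nat) (w : {poly F}) :
  'X^N - 1 %| ('X^g - 1) * w -> (j * g + c < N)%N ->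
  (residue_part N (j * g + c) w).[1] = (residue_part N c w).[1].
Proof.
move=> /dvdpP [h hE]; elim: j => [|j IHj] lt_N //.
have N_gt0 : (0 < N)%N by lia.
(* Compare the class j * g + c of w with the class (j + 1) * g + c of 'X^g * w,
   which differs from w by a multiple of 'X^N - 1. *)
rewrite -IHj; last by rewrite mulSn in lt_N; lia.
have -> : (j.+1 * g + c = (j * g + c) + g)%N by rewrite mulSn; lia.
rewrite -[in RHS](residue_part_shift g _ _ N_gt0).
have -> : 'X^g * w = (('X - 1) \Po 'X^N) * h + w.
  rewrite comp_polyB comp_polyX comp_polyC mulrC [_ * h]mulrC -hE; ring.
rewrite residue_partD // residue_part_comp_mul //; last by rewrite mulSn in lt_N; lia.
by rewrite !hornerE subrr mul0r add0r.
Qed.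

(** * The weight of a product of geometric sums *)

Lemma leq_weight_prod_geometric (n k : nat) (v : {poly F}) (a : 'I_k -> nat) :
  (0 < n)%N -> (0 < k)%N -> v.[1] != 0 -> (forall i, 0 < a i)%N ->
  (n <= weight (v * \prod_i \sum_(j < n) 'X^(a i) ^+ j)%R)%N.
Proof.
move=> n_gt0 k_gt0 v1 a_gt0.
have [m odd_m n_eq] := pfactor_coprime (isT : prime 2) n_gt0.
rewrite coprime2n in odd_m; move: (logn 2 n) n_eq => s; rewrite mulnC => n_eq.
have m_gt0 : (0 < m)%N by case: (m) odd_m.
pose g := \big[gcdn/0%N]_i a i; pose N := (g * m)%N.
have g_dvd i : (g %| a i)%N by apply: biggcdn_inf (dvdnn _).
have g_gt0 : (0 < g)%N := dvdn_gt0 (a_gt0 (Ordinal k_gt0)) (g_dvd _).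
have N_gt0 : (0 < N)%N by rewrite muln_gt0 g_gt0.
pose w := v * \prod_i \sum_(j < m) 'X^(a i) ^+ j.
pose p : {poly F} := \prod_i ('X^(a i %/ g) - 1).
have -> : v * \prod_i \sum_(j < n) 'X^(a i) ^+ j =
    (p ^+ (2 ^ s - 1) \Po 'X^N) * w.
  rewrite /w mulrCA; congr (_ * _); rewrite rmorphXn rmorph_prod /= -prodrXl.
  rewrite -big_split /=; apply: eq_bigr => i _.
  rewrite n_eq geometric_split; congr (_ ^+ _ * _).
  rewrite comp_polyB comp_polyC comp_Xn_poly -!exprM.
  by rewrite /N mulnAC [(g * _)%N]mulnC divnK.
have w1 : w.[1] != 0.
  rewrite /w hornerM mulf_neq0 // horner_prod; apply/prodf_neq0 => i _.
  rewrite horner_sum (eq_bigr (fun=> 1)); last by move=> j _; rewrite !hornerE !expr1n.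
  by rewrite sumr_const card_ord -(dvdn_pcharf charF2) dvdn2 odd_m.
(* ('X^(a i) - 1) times the i-th factor of w is 'X^(a i * m) - 1, and N divides a i * m. *)
have w_period : 'X^N - 1 %| ('X^g - 1) * w.
  apply: (big_ind (fun t => 'X^N - 1 %| ('X^t - 1) * w)) => [|x y|i _].
  - by rewrite expr0 subrr mul0r dvdp0.
  - exact: period_gcd.
  rewrite /w mulrCA (bigD1 i) //= [X in _ * X]mulrA -subrX1 -exprM.
  have -> : (a i * m = N * (a i %/ g))%N.
    by rewrite /N mulnAC [(g * _)%N]mulnC divnK.
  by rewrite exprM subrX1 -mulrA mulrCA dvdp_mulr.
(* The values at 1 of the parts of w add up to w.[1], so one of them is nonzero. *)
have [r r1] : exists r : 'I_N, (residue_part N r w).[1] != 0.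
  apply/existsP; apply: contraNT w1 => /existsPn r0.
  rewrite (horner1_residue_part w N_gt0) big1 // => r _; apply/eqP.
  by have := r0 r; rewrite negbK.
have lt_cg := ltn_pmod r g_gt0; set c := (r %% g)%N in lt_cg.
have part1 (j : 'I_m) : (residue_part N (j * g + c) w).[1] != 0.
  have lt_jN : (j * g + c < N)%N by have := ltn_ord j; rewrite /N; nia.
  rewrite (residue_part_period w_period lt_jN).
  by rewrite -(residue_part_period w_period (j := r %/ g)) -divn_eq.
have p_neq0 : p != 0.
  apply/prodf_neq0 => i _; rewrite -size_poly_gt0 size_XnsubC // divn_gt0 //.
  exact: dvdn_leq.
have p1 : p.[1] = 0.
  rewrite /p horner_prod (bigD1 (Ordinal k_gt0)) //=.
  by rewrite !hornerE expr1n subrr mul0r.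
(* Only the m classes congruent to c modulo g are kept. *)
rewrite (weight_residue_part _ N_gt0) /N mulnC.
rewrite (big_divmod _ _ _ (fun r => weight (residue_part _ r _))).
rewrite (bigD1 (Ordinal lt_cg)) //= (leq_trans _ (leq_addr _ _)) //.
rewrite n_eq mulnC -[X in (X * _)%N]card_ord -sum_nat_const; apply: leq_sum => j _.
rewrite [(m * g)%N]mulnC -/N residue_part_comp_mul //.
  exact: leq_weight_exp_ones.
by have := ltn_ord j; rewrite /N; nia.
Qed.

End CharTwo.

(** * Finite sets of integers as polynomials *)

(** Coefficients are taken in [bool], the field with two elements, so that a
    coefficient is a membership test. The absolute value is the identity on the
    nonnegative sets for which the correspondence is used. *)
Definition fset_poly (A : {fset int}) : {poly bool} := \sum_(z <- A) 'X^`|z|%N.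

Lemma coef_fset_poly (A : {fset int}) (m : nat) : (forall z, z \in A -> 0 <= z) ->
  (fset_poly A)`_m = (m%:Z \in A).
Proof.
move=> A_ge0; rewrite coef_sum -[RHS]andbT -(big_addb_pred1 A m%:Z xpredT).
apply: eq_fbigr => z zA _; rewrite coefXn andbT.
have := A_ge0 z zA; case: z {zA} => // z _; rewrite eqz_nat.
by case: eqP.
Qed.

Lemma leq_weight_fset_poly (A : {fset int}) : (forall z, z \in A -> 0 <= z) ->
  (weight (fset_poly A) <= #|` A|)%N.
Proof.
move=> A_ge0; set p := fset_poly A.
have -> : weight p = size [seq i%:Z | i <- iota 0 (size p) & p`_i].
  rewrite size_map size_filter -sum1_count big_mkcond /=.
  rewrite /weight -(big_mkord xpredT (fun i => (p`_i != 0)%R : nat)).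
  by rewrite /index_iota subn0; apply: eq_bigr => i _; case: p`_i.
apply: uniq_leq_size; first by rewrite map_inj_uniq ?filter_uniq ?iota_uniq // => x y [].
by move=> _ /mapP [i + ->]; rewrite mem_filter => /andP [+ _]; rewrite coef_fset_poly.
Qed.

Lemma horner1_fset_poly (A : {fset int}) : (fset_poly A).[1] = odd #|` A|.
Proof.
rewrite horner_sum (eq_bigr (fun=> 1)); last by move=> z _; rewrite hornerXn expr1n.
by rewrite card_fset_sum1 (big_morph odd oddD (erefl _)).
Qed.

(** Both sides count the pairs of given sum modulo 2. *)
Lemma fset_poly_oplus (A B : {fset int}) :
  (forall z, z \in A -> 0 <= z) -> (forall z, z \in B -> 0 <= z) ->
  fset_poly (oplus A B) = fset_poly A * fset_poly B.
Proof.
move=> A_ge0 B_ge0; apply/polyP => m; rewrite coef_sum.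
have -> := big_addb_oplus A B (fun z => ('X^`|z|%N : {poly bool})`_m).
rewrite mulr_suml coef_sum; apply: eq_fbigr => x xA _.
rewrite mulr_sumr coef_sum; apply: eq_fbigr => y yB _.
rewrite -exprD; congr (('X^_)`_m).
by have := A_ge0 x xA; have := B_ge0 y yB; lia.
Qed.

Lemma oplus_ge0 (A B : {fset int}) :
  (forall z, z \in A -> 0 <= z) -> (forall z, z \in B -> 0 <= z) ->
  forall z, z \in oplus A B -> 0 <= z.
Proof.
move=> A_ge0 B_ge0 z; rewrite !inE => /andP [/imfset2P [x xA [y yB ->]] _].
exact: addr_ge0 (A_ge0 _ xA) (B_ge0 _ yB).
Qed.

Lemma fset_poly_multiples (n : nat) (a : int) : 0 < a ->
  fset_poly (multiples n a) = 'X^`|a|%N * \sum_(j < n) 'X^`|a|%N ^+ j.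
Proof.
move=> a_gt0; rewrite /fset_poly big_imfset /=; last by move=> i j _ _ /= ; nia.
rewrite undup_id ?iota_uniq // (_ : iota 1 n = index_iota 1 n.+1); last first.
  by rewrite /index_iota subn1.
rewrite big_add1 big_mkord mulr_sumr.
by apply: eq_bigr => i _; rewrite abszM absz_nat mulnC exprM -exprS.
Qed.

Theorem theorem1p4 (n k : nat) (hn : (0 < n)%N) (hk : (0 < k)%N)
  (V : {fset int}) (hV : forall v : int, v \in V -> 0 < v) (hVodd : odd #|` V|)
  (a : 'I_k -> int) (ha : forall i, 0 < a i) :
  (n <= #|` oplus V (\big[oplus/[fset 0 : int]]_(i < k) multiples n (a i))|)%N.
Proof.
have V_ge0 z : z \in V -> 0 <= z by move/hV/ltW.
have mult_ge0 i z : z \in multiples n (a i) -> 0 <= z.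
  by case/imfsetP => j _ ->; rewrite mulr_ge0 // ltW.
have [S_ge0 S_poly] :
    (forall z, z \in \big[oplus/[fset 0 : int]]_(i < k) multiples n (a i) -> 0 <= z) /\
    fset_poly (\big[oplus/[fset 0 : int]]_(i < k) multiples n (a i)) =
    \prod_(i < k) fset_poly (multiples n (a i)).
  elim/big_ind2: _ => [|A p B q [A_ge0 <-] [B_ge0 <-]|i _].
  - by split=> [z /fset1P -> //|]; rewrite /fset_poly big_seq_fset1.
  - by split; [exact: oplus_ge0|exact: fset_poly_oplus].
  - by split=> // z; exact: mult_ge0.
apply: leq_trans (leq_weight_fset_poly (oplus_ge0 V_ge0 S_ge0)).
rewrite fset_poly_oplus // S_poly.
rewrite (eq_bigr _ (fun i _ => fset_poly_multiples n (ha i))) big_split mulrA /=.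
apply: leq_weight_prod_geometric => // [|i]; last by rewrite absz_gt0 gt_eqF.
rewrite hornerM horner1_fset_poly hVodd mul1r horner_prod.
by rewrite big1 // => i _; rewrite hornerXn expr1n.
Qed.
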